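(* Fix reals $\alpha,\beta,\gamma,\delta\ge0$ with $\alpha+\beta+\gamma+\delta=1$, and set $D:=1-4(\alpha\gamma+\alpha\delta+\beta\gamma)$ and $\mu:=(1-\sqrt D)/2$. Consider $n\to\infty$ along integers $n$ for which $l:=\alpha n$, $m:=(\alpha+\beta)n$, $k:=(\alpha+\gamma)n$ are integers, and let $X$ be distributed according to $p(\cdot\mid n,m,k,l)$, with probability denoted $\Pr_n$. Then for every $\varepsilon>0$, \[ \lim_{n\to\infty}\Pr_n\Bigl[\Bigl|\frac{X}{n}-\mu\Bigr|>\varepsilon\Bigr]=0, \] and consequently $\mathbb E[X]=n\mu+o(n)$.
   Context: For non-negative integers $n,m,k,l$ with $m,k\le n$ and $m+k-n\le l\le\min(m,k)$ (automatic above), let $M:=m-l$, $N:=n-m-k+l$. Let $\mathbb{C}^2$ have orthonormal basis $|0\rangle,|1\rangle$ and give $(\mathbb{C}^2)^{\otimes n}$ the induced Hermitian inner product. Define $|\Xi_{n,m|k,l}\rangle:=|1\rangle^{\otimes l}\otimes|0\rangle^{\otimes(k-l)}\otimes\binom{M+N}{M}^{-1/2}\sum_{I}|I\rangle$, the sum over all $I\in\{0,1\}^{n-k}$ with exactly $M$ ones (where $|i_1\cdots i_r\rangle=|i_1\rangle\otimes\cdots\otimes|i_r\rangle$). $\mathfrak S_n$ acts on $(\mathbb{C}^2)^{\otimes n}$ by permuting tensor factors. For $0\le x\le\lfloor n/2\rfloor$, $\mathsf P_{(n-x,x)}$ is the orthogonal projection onto the isotypic component of the irreducible $\mathfrak S_n$-representation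 labelled by the partition $(n-x,x)$, and $p(x\mid n,m,k,l):=\langle\Xi_{n,m|k,l}|\mathsf P_{(n-x,x)}|\Xi_{n,m|k,l}\rangle$, a probability mass function on $\{0,\dots,\lfloor n/2\rfloor\}$. *)

(* Defs.v *)
From HB Require Import structures.
From mathcomp Require Import all_boot all_order all_algebra all_fingroup.
From mathcomp Require Import mxrepresentation.
From mathcomp Require Import reals.
From mathcomp Require Import complex.

Set Implicit Arguments.
Unset Strict Implicit.
Unset Printing Implicit Defensive.
Import Order.TTheory GRing.Theory Num.Theory.
Local Open Scope ring_scope.

Section Tensor.
Variable R : realType.
Local Notation C := (R[i]).

Definition cbasis (n : nat) := {ffun 'I_n -> bool}.
Definition dimV (n : nat) := #|{: cbasis n}|.

Definition perm_act_mx (n : nat) (s : {perm 'I_n}) : 'M[C]_(dimV n) :=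
  \matrix_(i < dimV n, j < dimV n) ((enum_val j == [ffun t => (enum_val i : cbasis n) ((s^-1)%g t)])%:R).

Lemma perm_act_mx_repr n : mx_repr [set: {perm 'I_n}] (@perm_act_mx n).
Proof.
split.
  apply/matrixP => i j; rewrite !mxE invg1.
  have -> : [ffun t => (enum_val i : cbasis n) ((1 : {perm 'I_n})%g t)] = enum_val i.
    by apply/ffunP => t; rewrite ffunE perm1.
  by rewrite (inj_eq enum_val_inj) eq_sym.
move=> s t _ _; apply/matrixP => i j; rewrite !mxE.
pose g := [ffun u => (enum_val i : cbasis n) ((s^-1)%g u)].
rewrite (bigD1 (enum_rank g)) //= big1 ?addr0.
  rewrite !mxE enum_rankK eqxx mul1r; congr (_ %:R); congr (_ == _).
  by apply/ffunP => u; rewrite !ffunE invMg permM.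
move=> k nk; rewrite !mxE -/g.
have -> : (enum_val k == g) = false.
  by apply/eqP=> e; case/eqP: nk; rewrite -e enum_valK.
by rewrite mul0r.
Qed.

(** The permutation representation of S_n on (C^2)^{(x)n}: sigma permutes
    the tensor factors, |f> |-> |f o sigma^-1>  (row-vector convention). *)
Definition permrep (n : nat) : mx_representation C [set: {perm 'I_n}] (dimV n) :=
  MxRepresentation (@perm_act_mx_repr n).

Definition adjmx (p q : nat) (A : 'M[C]_(p, q)) : 'M[C]_(q, p) :=
  map_mx (@conjc R) A^T.

(** The state |Xi_{n,m|k,l}>, as a row vector in the computational basis
    (f i = true means the i-th tensor factor is |1>). *)
Definition Xi (n m k l : nat) : 'rV[C]_(dimV n) :=
  let M := (m - l)%N in
  let N := ((n + l) - (m + k))%N in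
  \row_(j < dimV n)
    (let f : cbasis n := enum_val j in
     if [forall i : 'I_n, (((i < l)%N ==> f i) && (((l <= i) && (i < k))%N ==> ~~ f i))]
        && (#|[set i : 'I_n | (k <= i)%N && f i]| == M)
     then (((Num.sqrt ('C(M + N, M)%:R : R))^-1)%:C)%C
     else 0).

(** Column data of a Young tableau of shape (n-x,x): column i has first-row
    entry (T i).1 and second-row entry (T i).2; all 2x entries distinct.
    (The remaining n-2x entries lie in singleton columns of the first row.) *)
Definition tab_valid (n x : nat) (T : {ffun 'I_x -> 'I_n * 'I_n}) : bool :=
  [forall i, forall j, ((T i).1 != (T j).2) &&
     ((i != j) ==> (((T i).1 != (T j).1) && ((T i).2 != (T j).2)))].

(** The polytabloid e_T = sum_{sigma in column group} sgn(sigma) {sigma T},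
    seen in (C^2)^{(x)n} through the S_n-isomorphism of the permutation
    module M^{(n-x,x)} with the span of the |f> having x ones (tabloid with
    second row S  |->  |1_S>). *)
Definition polytabloid (n x : nat) (T : {ffun 'I_x -> 'I_n * 'I_n}) : 'rV[C]_(dimV n) :=
  \row_(j < dimV n)
    (let f : cbasis n := enum_val j in
     if [forall p : 'I_n, (~~ [exists i, (p == (T i).1) || (p == (T i).2)]) ==> ~~ f p]
        && [forall i, f (T i).1 != f (T i).2]
     then (-1) ^+ #|[set i | f (T i).1]|
     else 0).

Definition specht_gens (n x : nat) : 'M[C]_(#|{: {ffun 'I_x -> 'I_n * 'I_n}}|, dimV n) :=
  \matrix_(r < #|{: {ffun 'I_x -> 'I_n * 'I_n}}|)
    (if tab_valid (enum_val r) then polytabloid (enum_val r) else 0).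

Definition specht (n x : nat) : 'M[C]_(dimV n) := (<< specht_gens n x >>)%MS.

Definition isotypic (n x : nat) : 'M[C]_(dimV n) :=
  component_mx (permrep n) (specht n x).

(** Orthogonal projection (acting on row vectors by right multiplication) onto
    the row space of U, for the standard Hermitian inner product <u,v> = u v^H. *)
Definition orth_proj (N : nat) (U : 'M[C]_N) : 'M[C]_N :=
  let B := row_base U in adjmx B *m invmx (B *m adjmx B) *m B.

Definition pmf (n m k l x : nat) : R :=
  complex.Re ((Xi n m k l *m orth_proj (isotypic n x) *m adjmx (Xi n m k l)) 0 0).

Definition dev_prob (n m k l : nat) (mu eps : R) : R :=
  \sum_(x < n./2.+1 | eps < `| x%:R / n%:R - mu |) pmf n m k l x.

Definition expectation (n m k l : nat) : R :=
  \sum_(x < n./2.+1) x%:R * pmf n m k l x.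

End Tensor.

(* Main.v *)
(* Up to an additive constant, the sum Q of 1 - rho(i j) over all ordered pairs
   of sites is minus twice the sum of all transpositions (the Casimir
   operator of SU(2)); it acts on the isotypic component of (n-x,x) as the
   scalar 2x(n-x+1). The vector Xi has <Q> = 2 n^2 mu(1-mu) exactly, and its
   variance is O(n^3): a swap of a frozen site with another site creates a
   wrong frozen bit, and a basis state with a wrong bit is brought back by
   at most 2n swaps. Hence X(n-X+1)/n^2 concentrates at mu(1-mu) by
   Chebyshev, and t(1-t) separates points of [0,1/2] quadratically.

   For the expectation one also needs the probabilities to sum to 1, i.e. that
   the components with x <= n/2 exhaust the space. In a simple submodule (up
   to isomorphism, by lowering) pick a vector killed by the lowering
   operator and antisymmetrise it in as many disjoint pairs of sites as
   possible: what remains is a multiple of a polytabloid. *)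
Require Import Defs.
From HB Require Import structures.
From mathcomp Require Import all_boot all_order all_algebra all_fingroup.
From mathcomp Require Import mxrepresentation reals complex.
From mathcomp Require Import primitive_action alt.
From mathcomp Require Import ring lra.
From mathcomp Require Import zify.
Set Implicit Arguments.
Unset Strict Implicit.
Unset Printing Implicit Defensive.
Import Order.TTheory GRing.Theory Num.Theory.
Local Open Scope ring_scope.

(** * Orthogonal projections and the spectral decomposition of a Hermitian matrix *)

Section OrthogonalProjections.
Variable R : realType.
Local Notation C := (R[i]).

Lemma adjmxM p q r (A : 'M[C]_(p, q)) (B : 'M[C]_(q, r)) :
  adjmx (A *m B) = adjmx B *m adjmx A.
Proof. by rewrite /adjmx trmx_mul map_mxM. Qed.

Lemma adjmxK p q (A : 'M[C]_(p, q)) : adjmx (adjmx A) = A.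
Proof. by apply/matrixP=> i j; rewrite !mxE conjcK. Qed.

Lemma adjmx_inv p (A : 'M[C]_p) : adjmx (invmx A) = invmx (adjmx A).
Proof. by rewrite /adjmx trmx_inv map_invmx. Qed.

Lemma adjmxB p q (A B : 'M[C]_(p, q)) : adjmx (A - B) = adjmx A - adjmx B.
Proof. by apply/matrixP=> i j; rewrite !mxE rmorphB. Qed.

Lemma adjmx_sum p q (I : finType) (A : I -> 'M[C]_(p, q)) :
  adjmx (\sum_i A i) = \sum_i adjmx (A i).
Proof.
by apply/matrixP=> i j; rewrite !mxE !summxE rmorph_sum; apply: eq_bigr => x _; rewrite !mxE.
Qed.

Definition sqnorm N (v : 'rV[C]_N) : R := complex.Re ((v *m adjmx v) 0 0).

Lemma sqnormE N (v : 'rV[C]_N) :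
  sqnorm v = \sum_j (complex.Re (v 0 j) ^+ 2 + complex.Im (v 0 j) ^+ 2).
Proof.
rewrite /sqnorm mxE raddf_sum; apply: eq_bigr => j _; rewrite !mxE.
by case: (v 0 j) => a b /=; rewrite mulrN opprK -!expr2.
Qed.

Lemma sqnorm_ge0 N (v : 'rV[C]_N) : 0 <= sqnorm v.
Proof. by rewrite sqnormE sumr_ge0 // => j _; rewrite addr_ge0 ?sqr_ge0. Qed.

Lemma sqnorm_eq0 N (v : 'rV[C]_N) : sqnorm v = 0 -> v = 0.
Proof.
rewrite sqnormE => /psumr_eq0P v0; apply/rowP=> j; rewrite mxE.
have /eqP := v0 (fun i _ => addr_ge0 (sqr_ge0 _) (sqr_ge0 _)) j isT.
rewrite paddr_eq0 ?sqr_ge0 // !sqrf_eq0.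
by case: (v 0 j) => a b /= /andP[/eqP-> /eqP->].
Qed.

Lemma sqnormZ N (a : R) (v : 'rV[C]_N) :
  sqnorm ((a%:C)%C *: v) = a ^+ 2 * sqnorm v.
Proof.
rewrite !sqnormE mulr_sumr; apply: eq_bigr => j _; rewrite mxE.
by case: (v 0 j) => x y /=; ring.
Qed.

(** If [w] kills the Gram matrix, then [w B] has squared norm [w B B^H w^H = 0], so [w B = 0], and
    freeness of [B] gives [w = 0]. *)
Lemma gram_unit p q (B : 'M[C]_(p, q)) : row_free B -> B *m adjmx B \in unitmx.
Proof.
move=> freeB; rewrite -row_free_unit -kermx_eq0.
apply/eqP/row_matrixP=> i; rewrite row0; set w := row i _.
have w0 : w *m (B *m adjmx B) = 0 by apply/sub_kermxP; rewrite row_sub.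
have wB : w *m B = 0.
  apply: sqnorm_eq0; rewrite /sqnorm adjmxM !mulmxA -(mulmxA w) w0 mul0mx.
  by rewrite mxE.
by apply/eqP; rewrite -(mulmx_free_eq0 w freeB) wB.
Qed.

Variable N : nat.
Implicit Types (U Q : 'M[C]_N) (v : 'rV[C]_N).

Lemma orth_proj_adj U : adjmx (orth_proj U) = orth_proj U.
Proof.
rewrite /orth_proj; move: (row_base U) => B.
by rewrite !adjmxM adjmx_inv adjmxM adjmxK mulmxA.
Qed.

Lemma orth_proj_id p (W : 'M[C]_(p, N)) U : (W <= U)%MS -> W *m orth_proj U = W.
Proof.
rewrite -(eq_row_base U) => /submxP[D ->]; rewrite /orth_proj.
have := gram_unit (row_base_free U); move: (row_base U) D => B D uB.
by rewrite -!mulmxA (mulmxA B) (mulmxA (B *m _)) mulmxV ?mul1mx.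
Qed.

Lemma orth_proj_sub U : (orth_proj U <= U)%MS.
Proof. by rewrite -(eq_row_base U) submxMl. Qed.

Lemma orth_proj_idem U : orth_proj U *m orth_proj U = orth_proj U.
Proof. by rewrite orth_proj_id ?orth_proj_sub. Qed.

Local Opaque orth_proj.

(** The projection is Hermitian and idempotent. This turns the probabilities [pmf] into squared
    norms. *)
Lemma sqnorm_orth_proj U v :
  complex.Re ((v *m orth_proj U *m adjmx v) 0 0) = sqnorm (v *m orth_proj U).
Proof.
rewrite /sqnorm adjmxM orth_proj_adj mulmxA -[in RHS](mulmxA v).
by rewrite orth_proj_idem.
Qed.

Section SpectralDecomposition.
Variables (I : finType) (Q : 'M[C]_N) (U : I -> 'M[C]_N) (q : I -> nat).
Hypothesis adjQ : adjmx Q = Q.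
Hypothesis eigU : forall i, U i *m Q = (q i)%:R *: U i.
Hypothesis inj_q : injective q.
Hypothesis sumU : (1%:M <= \sum_i U i)%MS.

Local Notation P i := (orth_proj (U i)).

Lemma orth_proj_eigen_l i : P i *m Q = (q i)%:R *: P i.
Proof.
by have /submxP[D ->] := orth_proj_sub (U i); rewrite -mulmxA eigU scalemxAr.
Qed.

Lemma orth_proj_eigen_r i : Q *m P i = (q i)%:R *: P i.
Proof.
rewrite -[LHS]adjmxK adjmxM orth_proj_adj adjQ orth_proj_eigen_l.
rewrite -[in RHS]orth_proj_adj; apply/matrixP=> a b.
by rewrite !mxE rmorphM rmorph_nat.
Qed.

(** As [Q] is Hermitian, [P i *m Q *m P j] equals both [q i] and [q j] times [P i *m P j], and the
    eigenvalues differ. *)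
Lemma orth_proj_ortho i j : i != j -> P i *m P j = 0.
Proof.
move=> nij; have: P i *m Q *m P j = P i *m (Q *m P j) by rewrite mulmxA.
rewrite orth_proj_eigen_l orth_proj_eigen_r -scalemxAl -scalemxAr.
move/eqP; rewrite -subr_eq0 -scalerBl scaler_eq0 subr_eq0 eqr_nat (inj_eq inj_q).
by rewrite (negPf nij) => /eqP.
Qed.

(** Write 1 as the sum of the [W i *m U i]; multiplying by [P i] kills every term but the i-th and
    fixes that one. *)
Lemma sum_orth_proj : \sum_i P i = 1%:M.
Proof.
have /sub_sumsmxP[W defW] := sumU.
have PW i : 1%:M *m P i = W i *m U i.
  rewrite {1}defW mulmx_suml (bigD1 i) //= big1 ?addr0.
    by rewrite orth_proj_id ?submxMl.
  move=> j nji; rewrite -{1}[U j](orth_proj_id (submx_refl _)).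
  by rewrite -mulmxA -mulmxA orth_proj_ortho // !mulmx0.
by rewrite [RHS]defW; apply: eq_bigr => i _; rewrite -PW mul1mx.
Qed.

Lemma sqnorm_sum_orth_proj v : sqnorm v = \sum_i sqnorm (v *m P i).
Proof.
rewrite {1}/sqnorm -[v in v *m _]mulmx1 -sum_orth_proj mulmx_sumr mulmx_suml.
rewrite summxE raddf_sum; apply: eq_bigr => i _.
by rewrite -sqnorm_orth_proj.
Qed.

(** [Q] acts on the range of [P i] as the scalar [q i]. This reads the second moment of [Q] about
    [c] as a moment of the spectral distribution of [v]. *)
Lemma sqnorm_shift (c : R) v :
  sqnorm (v *m Q - (c%:C)%C *: v) =
    \sum_i ((q i)%:R - c) ^+ 2 * sqnorm (v *m P i).
Proof.
rewrite sqnorm_sum_orth_proj; apply: eq_bigr => i _.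
rewrite mulmxBl -mulmxA orth_proj_eigen_r -scalemxAl -scalemxAr -scalerBl.
by rewrite -sqnormZ; congr (sqnorm (_ *: _)); rewrite rmorphB rmorph_nat.
Qed.

End SpectralDecomposition.
End OrthogonalProjections.


(** * Permutations with prescribed values, and signs *)

(** The full symmetric group is transitive on tuples of [#|A|] distinct points, and [g] and [h] are
    two such tuples. *)
Lemma perm_of_inj (A T : finType) (g h : A -> T) :
  injective g -> injective h -> exists s : {perm T}, forall a, s (g a) = h a.
Proof.
move=> inj_g inj_h.
have leAT : (#|A| <= #|T|)%N by exact: leq_card inj_g.
have trT := ntransitive_weak leAT (Sym_trans T).
have dt (f : A -> T) : injective f -> codom_tuple f \in dtuple_on #|A| [set: T].
  move=> /injectiveP uf; rewrite inE; apply/andP; split; first exact: uf.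
  by apply/subsetP=> y; rewrite inE.
have [s _ /(congr1 val) /= def_h] := atransP2 trT (dt g inj_g) (dt h inj_h).
exists s => a; move: def_h; rewrite /codom /image_mem -map_comp => /eq_in_map.
by move=> /(_ a (mem_enum _ _)).
Qed.

Lemma tperm_disjoint_comm (T : finType) (a b c d : T) :
  a != c -> a != d -> b != c -> b != d ->
  (tperm a b * tperm c d = tperm c d * tperm a b)%g.
Proof.
move=> ac ad bc bd; rewrite [RHS]conjgC tpermJ.
by rewrite !tpermD // eq_sym.
Qed.

Lemma sign_card_prod (R : pzRingType) (I : finType) (P : pred I) :
  (-1) ^+ #|[set i | P i]| = \prod_i (-1) ^+ P i :> R.
Proof.
rewrite -prodr_const big_mkcond; apply: eq_bigr => i _.
by rewrite inE; case: (P i).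
Qed.

(** * The Casimir and lowering operators in the computational basis *)

Section Amplitudes.
Variables (R : realType) (n : nat).
Local Notation C := (R[i]).
Local Notation rho := (@perm_act_mx R n).
Implicit Types (f g : cbasis n) (s : {perm 'I_n}) (u v : 'rV[C]_(dimV n)).

Definition amp v f : C := v 0 (enum_rank f).

Lemma ampP u v : amp u =1 amp v -> u = v.
Proof. by move=> eq_uv; apply/rowP=> j; have := eq_uv (enum_val j); rewrite /amp enum_valK. Qed.

Lemma ampD u v f : amp (u + v) f = amp u f + amp v f.
Proof. by rewrite /amp mxE. Qed.

Lemma ampN v f : amp (- v) f = - amp v f.
Proof. by rewrite /amp mxE. Qed.

Lemma ampZ c v f : amp (c *: v) f = c * amp v f.
Proof. by rewrite /amp mxE. Qed.

Lemma amp0 f : amp 0 f = 0.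
Proof. by rewrite /amp mxE. Qed.

Definition precomp f s : cbasis n := [ffun t => f (s t)].

Lemma amp_act v s f : amp (v *m rho s) f = amp v (precomp f s).
Proof.
rewrite /amp mxE (bigD1 (enum_rank (precomp f s))) //= big1 ?addr0.
  rewrite mxE !enum_rankK.
  suff -> : f == [ffun t => precomp f s (s^-1%g t)] by rewrite mulr1.
  by apply/eqP/ffunP=> t; rewrite !ffunE permKV.
move=> i ni; rewrite mxE enum_rankK.
case: eqP => [ef|_]; last by rewrite mulr0.
case/eqP: ni; rewrite -(enum_valK i); congr enum_rank.
by apply/ffunP=> t; rewrite ffunE ef ffunE permK.
Qed.

Lemma perm_actM s1 s2 : rho (s1 * s2)%g = rho s1 *m rho s2.
Proof. by have [_ ->] := perm_act_mx_repr R n; rewrite ?inE. Qed.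

Lemma perm_act1 : rho 1%g = 1%:M.
Proof. by have [-> _] := perm_act_mx_repr R n. Qed.

Lemma adjmx_perm_act s : adjmx (rho s) = rho s^-1%g.
Proof.
apply/matrixP=> i j; rewrite !mxE invgK; set b := (_ == _).
have -> : b = (enum_val j == [ffun t => (enum_val i : cbasis n) (s t)]).
  by apply/eqP/eqP=> ->; apply/ffunP=> t; rewrite !ffunE ?permK ?permKV.
exact: conjc_nat.
Qed.

Definition casimir : 'M[C]_(dimV n) := \sum_i \sum_j (1%:M - rho (tperm i j)).

Lemma amp_casimir v f :
  amp (v *m casimir) f = \sum_i \sum_j (amp v f - amp v (precomp f (tperm i j))).
Proof.
rewrite /casimir mulmx_sumr /amp summxE; apply: eq_bigr => i _.
rewrite mulmx_sumr summxE; apply: eq_bigr => j _.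
by rewrite mulmxBr mulmx1 2!mxE; congr (_ - _); apply: amp_act.
Qed.

Lemma adjmx_casimir : adjmx casimir = casimir.
Proof.
rewrite /casimir adjmx_sum; apply: eq_bigr => i _.
rewrite adjmx_sum; apply: eq_bigr => j _.
by rewrite adjmxB -perm_act1 !adjmx_perm_act invg1 tpermV.
Qed.

(** Conjugation by [s] permutes the transpositions, so it only reindexes the double sum. *)
Lemma casimir_comm s : rho s *m casimir = casimir *m rho s.
Proof.
rewrite /casimir mulmx_sumr mulmx_suml [RHS](reindex_inj (@perm_inj _ s^-1%g)).
apply: eq_bigr => i _.
rewrite mulmx_sumr mulmx_suml [RHS](reindex_inj (@perm_inj _ s^-1%g)).
apply: eq_bigr => j _.
rewrite mulmxBr mulmxBl mulmx1 mul1mx -!perm_actM; congr (_ - rho _).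
by rewrite -tpermJ conjgE invgK !mulgA mulgKV.
Qed.

Definition setbit g t : cbasis n := [ffun p => (p == t) || g p].
Definition clearbit g t : cbasis n := [ffun p => (p != t) && g p].

(** Acting on row vectors from the right, this sends [|f>] to the sum of the words obtained by
    clearing a single 1 of [f]: the total spin-lowering operator. *)
Definition lowering : 'M[C]_(dimV n) :=
  \matrix_(i, j) \sum_(t | ~~ (enum_val j : cbasis n) t)
     (enum_val i == setbit (enum_val j) t)%:R.

Lemma amp_lowering v g :
  amp (v *m lowering) g = \sum_(t | ~~ g t) amp v (setbit g t).
Proof.
rewrite /amp mxE; under eq_bigr do rewrite mxE enum_rankK mulr_sumr.
rewrite exchange_big; apply: eq_bigr => t _.
rewrite (bigD1 (enum_rank (setbit g t))) //= big1 ?addr0.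
  by rewrite enum_rankK eqxx mulr1.
move=> i ni; case: eqP => [ei|_]; last by rewrite mulr0.
by case/eqP: ni; rewrite -ei enum_valK.
Qed.

Lemma lowering_comm s : rho s *m lowering = lowering *m rho s.
Proof.
apply/row_matrixP=> i; rewrite !row_mul; apply: ampP => g.
rewrite !rowE -mulmxA amp_act !mulmxA !amp_lowering.
rewrite (reindex_inj (@perm_inj _ s)) /=.
apply: eq_big => [t|t _]; first by rewrite ffunE.
rewrite amp_act; congr amp; apply/ffunP=> p.
by rewrite !ffunE (inj_eq perm_inj).
Qed.

Definition homogeneous x v := forall f, amp v f != 0 -> #|[set p | f p]| = x.

Lemma precomp_tperm_id f i j : f i = f j -> precomp f (tperm i j) = f.
Proof.
by move=> fij; apply/ffunP=> t; rewrite ffunE; case: tpermP => [->|->|].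
Qed.

(* The Casimir operator on x-homogeneous vectors is 2x(n-x+1) minus twice the
   composite of lowering and raising. *)
Lemma casimir_eigen x v :
  homogeneous x v -> v *m lowering = 0 ->
  v *m casimir = (2 * (x * (n - x).+1))%:R *: v.
Proof.
move=> hv low0; apply: ampP => f; rewrite amp_casimir ampZ.
have [card_f|] := eqVneq #|[set p | f p]| x; last first.
  (* Swaps preserve the number of ones, so both sides vanish at words that do not have [x] ones. *)
  move=> nx; have v0 (h : cbasis n) : #|[set p | h p]| = #|[set p | f p]| -> amp v h = 0.
    by move=> eh; apply/eqP; apply: contraNT nx => /hv <-; rewrite eh.
  rewrite v0 // mulr0 big1 // => i _; rewrite big1 // => j _.
  rewrite v0 ?subrr // -(card_imset _ (@perm_inj _ (tperm i j))).
  apply: eq_card => p; rewrite inE; apply/imsetP/idP => [[q]|fp].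
    by rewrite inE ffunE => fq ->.
  by exists (tperm i j p); rewrite ?inE ?ffunE tpermK.
(* Evaluate [v *m lowering = 0] at [f] with the 1 at [i] cleared: the term at [i] is [amp v f], and
   the others are the swaps of [i] with the zeros of [f], which therefore add up to [- amp v f].
   There are [n - x] zeros. *)
have inner i : f i -> \sum_(j | ~~ f j) (amp v f - amp v (precomp f (tperm i j)))
    = (n - x).+1%:R * amp v f.
  move=> fi; have := congr1 (fun w => amp w (clearbit f i)) low0.
  rewrite amp_lowering amp0 (bigD1 i) /=; last by rewrite ffunE eqxx.
  have -> : setbit (clearbit f i) i = f.
    by apply/ffunP=> p; rewrite !ffunE; case: eqP => // ->.
  move/eqP; rewrite addrC addr_eq0 => /eqP hsum.
  rewrite sumrB sumr_const.
  rewrite [X in _ - X](_ : _ = - amp v f).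
    rewrite opprK -mulrSr mulr_natl; congr (_ *+ _.+1).
    apply/eqP; rewrite -(eqn_add2l x) subnKC; last first.
      by rewrite -card_f -[leqRHS](card_ord n) max_card.
    rewrite -card_f -[eqbRHS](card_ord n) -(cardsC [set p | f p]) eqn_add2l.
    by apply/eqP/eq_card => p; rewrite !inE.
  rewrite -hsum; apply: eq_big => [j|j nfj].
    by rewrite ffunE; case: eqP => [->|]; rewrite ?fi ?andbT.
  congr amp; apply/ffunP=> p; rewrite !ffunE.
  case: tpermP => [->|->|/eqP/negPf-> /eqP/negPf->//]; first by
    rewrite eqxx (negPf nfj) orbF; case: eqP nfj => // <-; rewrite fi.
  by rewrite eqxx.
(* Pairs with equal bits contribute 0; the others split by which of the two sites holds the 1,
   giving two equal sums. *)
have split2 (F : 'I_n -> 'I_n -> C) : (forall i j, f i = f j -> F i j = 0) ->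
    \sum_i \sum_j F i j = \sum_(i | f i) \sum_(j | ~~ f j) F i j
                        + \sum_(i | f i) \sum_(j | ~~ f j) F j i.
  move=> F0; rewrite (bigID (fun i => f i)) /=; congr (_ + _).
    apply: eq_bigr => i fi; rewrite (bigID (fun j => f j)) /= big1 ?add0r //.
    by move=> j fj; rewrite F0 // fi fj.
  rewrite [RHS]exchange_big /=; apply: eq_bigr => i nfi.
  rewrite (bigID (fun j => f j)) /= [X in _ + X]big1 ?addr0 // => j nfj.
  by rewrite F0 // (negPf nfi) (negPf nfj).
rewrite split2 => [|i j fij]; last by rewrite precomp_tperm_id ?subrr.
have -> : \sum_(i | f i) \sum_(j | ~~ f j)
              (amp v f - amp v (precomp f (tperm j i)))
        = \sum_(i | f i) \sum_(j | ~~ f j)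
              (amp v f - amp v (precomp f (tperm i j))).
  by apply: eq_bigr => i _; apply: eq_bigr => j _; rewrite tpermC.
rewrite (eq_bigr _ inner) sumr_const.
have -> : #|(fun i => f i)| = x by rewrite -card_f; apply: eq_card => p; rewrite inE.
by rewrite -mulrnAl -mulrDl -mulrnA -natrD addnn -mul2n (mulnC x).
Qed.

End Amplitudes.


(** * Polytabloids and the Casimir eigenvalue of an isotypic component *)

Section Polytabloids.
Variables (R : realType) (n : nat).
Local Notation C := (R[i]).
Local Notation rho := (@perm_act_mx R n).
Local Notation columns x := ({ffun 'I_x -> 'I_n * 'I_n}).
Implicit Types (f g : cbasis n) (s : {perm 'I_n}) (u v w : 'rV[C]_(dimV n)).

Definition used x (T : columns x) (p : 'I_n) :=
  [exists i, (p == (T i).1) || (p == (T i).2)].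

Lemma usedP x (T : columns x) p :
  reflect (exists i, p = (T i).1 \/ p = (T i).2) (used T p).
Proof.
apply: (iffP existsP) => -[i Ti]; exists i; first by case/orP: Ti => /eqP; auto.
by case: Ti => ->; rewrite eqxx ?orbT.
Qed.

Definition transversal x (T : columns x) f :=
  [forall p, ~~ used T p ==> ~~ f p] && [forall i, f (T i).1 != f (T i).2].

Lemma amp_polytabloid x (T : columns x) f :
  amp (polytabloid R T) f =
    if transversal T f then \prod_i (-1) ^+ f (T i).1 else 0.
Proof.
rewrite /amp mxE enum_rankK; congr (if _ then _ else _).
exact: (sign_card_prod _ (fun i => f (T i).1)).
Qed.

Lemma transversal_amp x (T : columns x) f :
  transversal T f = (amp (polytabloid R T) f != 0).
Proof.
rewrite amp_polytabloid; case: ifP => _; last by rewrite eqxx.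
by apply/esym/prodf_neq0 => i _; rewrite signr_eq0.
Qed.

Definition col_act x (T : columns x) s : columns x :=
  [ffun i => (s (T i).1, s (T i).2)].

Lemma used_col_act x (T : columns x) s p : used (col_act T s) (s p) = used T p.
Proof. by apply: eq_existsb => i; rewrite ffunE /= !(inj_eq perm_inj). Qed.

Lemma polytabloid_act x (T : columns x) s :
  polytabloid R T *m rho s = polytabloid R (col_act T s).
Proof.
apply: ampP => f; rewrite amp_act !amp_polytabloid.
congr (if _ then _ else _); last by apply: eq_bigr => i _; rewrite !ffunE.
congr (_ && _); last by apply: eq_forallb => i; rewrite !ffunE.
apply/forallP/forallP=> fp p; last by have := fp (s p); rewrite used_col_act ffunE.
by have := fp (s^-1%g p); rewrite -(used_col_act T s) ffunE permKV.
Qed.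

Lemma tab_validP x (T : columns x) :
  reflect [/\ injective (fun i => (T i).1), injective (fun i => (T i).2)
            & forall i j, (T i).1 != (T j).2] (tab_valid T).
Proof.
apply: (iffP idP) => [/forallP vT|[inj1 inj2 ne12]].
  have vTij i j := forallP (vT i) j.
  split=> [i j e|i j e|i j]; last by case/andP: (vTij i j).
  - apply/eqP; apply: contraT => nij; case/andP: (vTij i j) => _.
    by rewrite nij e eqxx.
  - apply/eqP; apply: contraT => nij; case/andP: (vTij i j) => _.
    by rewrite nij e eqxx andbF.
apply/forallP=> i; apply/forallP=> j; rewrite ne12 /=; apply/implyP=> nij.
by rewrite (inj_eq inj1) (inj_eq inj2) nij.
Qed.

Definition tab_points x (T : columns x) (a : 'I_x + 'I_x) :=
  match a with inl i => (T i).1 | inr i => (T i).2 end.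

Lemma tab_points_inj x (T : columns x) : tab_valid T -> injective (tab_points T).
Proof.
case/tab_validP=> inj1 inj2 ne12 [i|i] [j|j] /=.
- by move/inj1->.
- by move=> e; have := ne12 i j; rewrite e eqxx.
- by move=> e; have := ne12 j i; rewrite e eqxx.
- by move/inj2->.
Qed.

Lemma tab_size x (T : columns x) : tab_valid T -> (x + x <= n)%N.
Proof.
move/tab_points_inj/leq_card; by rewrite card_sum !card_ord.
Qed.

(** The [2x] entries of each tableau are distinct, so some permutation matches them. Hence a single
    polytabloid generates the whole Specht module. *)
Lemma col_act_transitive x (T T' : columns x) :
  tab_valid T -> tab_valid T' -> exists s, col_act T s = T'.
Proof.
move=> /tab_points_inj injT /tab_points_inj injT'.
have [s sT] := perm_of_inj injT injT'; exists s; apply/ffunP=> i.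
by rewrite ffunE (sT (inl i)) (sT (inr i)) /=; case: (T' i).
Qed.

Lemma col_act_valid x (T : columns x) s : tab_valid T -> tab_valid (col_act T s).
Proof.
case/tab_validP=> inj1 inj2 ne12; apply/tab_validP; split=> [i j|i j|i j].
- by rewrite !ffunE /= => /perm_inj/inj1.
- by rewrite !ffunE /= => /perm_inj/inj2.
- by rewrite !ffunE /= (inj_eq perm_inj).
Qed.

Definition col_swap x (T : columns x) i : {perm 'I_n} := tperm (T i).1 (T i).2.
Definition col_antisym x (T : columns x) w :=
  forall i, w *m rho (col_swap T i) = - w.

(** The swap of column [i] fixes [f], so antisymmetry reads [amp w f = - amp w f]. *)
Lemma col_antisym0 x (T : columns x) w f i :
  col_antisym T w -> f (T i).1 = f (T i).2 -> amp w f = 0.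
Proof.
move=> /(_ i)/(congr1 (fun u => amp u f)); rewrite amp_act ampN => hw fi.
move: hw; rewrite precomp_tperm_id // => /eqP.
by rewrite -addr_eq0 -mulr2n mulrn_eq0 /= => /eqP.
Qed.

Lemma col_swap_other x (T : columns x) i j : tab_valid T -> j != i ->
  (col_swap T i (T j).1 = (T j).1) * (col_swap T i (T j).2 = (T j).2).
Proof.
move=> /tab_validP[inj1 inj2 ne12] nji; split; apply: tpermD.
- by rewrite (inj_eq inj1) eq_sym.
- by rewrite eq_sym ne12.
- by rewrite ne12.
- by rewrite (inj_eq inj2) eq_sym.
Qed.

Lemma polytabloid_antisym x (T : columns x) :
  tab_valid T -> col_antisym T (polytabloid R T).
Proof.
move=> vT i; rewrite polytabloid_act; apply: ampP => f; rewrite ampN !amp_polytabloid.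
have -> : transversal (col_act T (col_swap T i)) f = transversal T f.
  congr (_ && _).
    apply: eq_forallb => p; congr (~~ _ ==> _); apply: eq_existsb => j.
    rewrite ffunE /=; have [->|nji] := eqVneq j i; last by rewrite !col_swap_other.
    by rewrite /col_swap tpermL tpermR orbC.
  apply: eq_forallb => j; rewrite ffunE /=.
  have [->|nji] := eqVneq j i; last by rewrite !col_swap_other.
  by rewrite /col_swap tpermL tpermR eq_sym.
case: ifP => [/andP[_ /forallP/(_ i) fi]|_]; last by rewrite oppr0.
rewrite (bigD1 i) //= [in RHS](bigD1 i) //= -mulNr; congr (_ * _).
  rewrite ffunE /= /col_swap tpermL.
  by case: (f _) fi; case: (f _) => //=; rewrite ?expr1 ?expr0 ?opprK.
by apply: eq_bigr => j nji; rewrite ffunE /= col_swap_other.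
Qed.

Lemma polytabloid_homogeneous x (T : columns x) :
  tab_valid T -> homogeneous x (polytabloid R T).
Proof.
move=> vT f; rewrite amp_polytabloid; case: ifP; rewrite ?eqxx //.
case/andP=> /forallP unused0 /forallP half _.
(* [phi i] is the site of column [i] that holds the 1; the ones of [f] are exactly these [x]
   sites. *)
pose phi i := tab_points T (if f (T i).1 then inl i else inr i).
have inj_phi : injective phi.
  by move=> i j /(tab_points_inj vT); case: (f _) (f _) => [] [] // [].
rewrite -[RHS](card_ord x) -cardsT -(card_imset _ inj_phi).
apply: eq_card => p; rewrite inE; apply/idP/imsetP=> [fp|[i _ ->]].
  have up : used T p by apply: contraT => /(implyP (unused0 p)); rewrite fp.
  case/usedP: up => i; case=> ep; exists i => //; rewrite /phi; have := half i; rewrite -ep fp //.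
  by case: ifP.
by rewrite /phi; case: ifP => //= fi; have := half i; rewrite fi; case: (f _).
Qed.

(* Lowering commutes with the swaps, so the result is still antisymmetric in
   every column, yet on each of its terms some column has both bits 0. *)
Lemma polytabloid_lowering x (T : columns x) :
  tab_valid T -> polytabloid R T *m lowering R n = 0.
Proof.
move=> vT; set w := _ *m _.
have anti_w : col_antisym T w.
  by move=> i; rewrite /w -mulmxA -lowering_comm mulmxA polytabloid_antisym ?mulNmx.
apply: ampP => g; rewrite amp0 amp_lowering.
have [/existsP[t /andP[ngt]]|] :=
  boolP [exists t, ~~ g t && (amp (polytabloid R T) (setbit g t) != 0)]; last first.
  rewrite negb_exists => /forallP g0; rewrite big1 // => t ngt.
  by have := g0 t; rewrite ngt /= negbK => /eqP.
rewrite amp_polytabloid; case: ifP; rewrite ?eqxx // => /andP[/forallP un /forallP half] _.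
have ut : used T t by apply: contraT => /(implyP (un t)); rewrite ffunE eqxx.
case/usedP: ut => i ti.
rewrite -amp_lowering; apply: (@col_antisym0 _ T _ _ i anti_w).
have := half i; have [_ _ ne12] := tab_validP _ vT; have := ne12 i i.
rewrite !ffunE; case: ti => <-; rewrite eqxx (negPf ngt) /=.
  by rewrite eq_sym => /negPf->; case: (g _).
by move/negPf->; case: (g _).
Qed.

(** In terms of the total spin [j = n/2 - x] this is [2 (n/2)(n/2 + 1) - 2 j (j + 1)]. *)
Definition casimir_ev x := (2 * (x * (n - x).+1))%N.

Lemma polytabloid_casimir x (T : columns x) : tab_valid T ->
  polytabloid R T *m casimir R n = (casimir_ev x)%:R *: polytabloid R T.
Proof.
by move=> vT; apply: casimir_eigen (polytabloid_homogeneous vT) (polytabloid_lowering vT).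
Qed.

Lemma specht_eigen x : (specht R n x <= kermx (casimir R n - ((casimir_ev x)%:R)%:M))%MS.
Proof.
rewrite genmxE; apply/row_subP=> r; rewrite rowK; case: ifP => [vT|_]; last exact: sub0mx.
by apply/sub_kermxP; rewrite mulmxBr polytabloid_casimir // mul_mx_scalar subrr.
Qed.

Lemma casimir_hom m (W : 'M[C]_(m, dimV n)) (h : 'M[C]_(dimV n)) :
  (W <= dom_hom_mx (permrep R n) h)%MS -> W *m casimir R n *m h = W *m h *m casimir R n.
Proof.
move/hom_mxP=> hW; rewrite /casimir !(mulmx_sumr, mulmx_suml).
apply: eq_bigr => i _; rewrite !(mulmx_sumr, mulmx_suml); apply: eq_bigr => j _.
by rewrite !mulmxBr mulmxBl !mulmx1 (hW _ (in_setT _)).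
Qed.

(** The eigenspace [K] contains the Specht module and is itself a submodule, the Casimir being
    central. The component is generated by the images of one Specht vector under homomorphisms;
    these commute with the Casimir, so the images stay in [K]. *)
Lemma isotypic_eigen x :
  isotypic R n x *m casimir R n = (casimir_ev x)%:R *: isotypic R n x.
Proof.
set K := kermx (casimir R n - ((casimir_ev x)%:R)%:M).
have modK : mxmodule (permrep R n) K.
  apply: kermx_centg_module; apply/centgmxP=> s _.
  by rewrite mulmxBr mulmxBl scalar_mxC casimir_comm.
suff /sub_kermxP : (isotypic R n x <= K)%MS.
  by rewrite mulmxBr mul_mx_scalar => /eqP; rewrite subr_eq0 => /eqP.
have -> : isotypic R n x = component_mx_expr (permrep R n) (specht R n x).
  by rewrite /isotypic; move: (specht R n x) => U; rewrite unlock.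
apply/sumsmx_subP=> i _; apply: cyclic_mx_sub modK _.
have /row_hom_mxP[h homh <-] : (row i (row_hom_mx (permrep R n) (nz_row (specht R n x)))
   <= row_hom_mx (permrep R n) (nz_row (specht R n x)))%MS by rewrite row_sub.
have /sub_kermxP := submx_trans (nz_row_sub _) (specht_eigen x).
rewrite mulmxBr mul_mx_scalar => /eqP; rewrite subr_eq0 => /eqP eig.
apply/sub_kermxP; rewrite mulmxBr mul_mx_scalar -casimir_hom // eig.
by rewrite -scalemxAl subrr.
Qed.

(** The values at distinct [x] and [y] agree only if [x + y = n + 1], which [2x <= n] and [2y <= n]
    exclude. *)
Lemma casimir_ev_inj : injective (fun x : 'I_(n./2).+1 => casimir_ev x).
Proof.
move=> x y /eqP; rewrite /casimir_ev eqn_pmul2l // => /eqP e; apply/val_inj => /=.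
have := ltn_ord x; have := ltn_ord y; move: (val x) (val y) e => a b e hb ha.
have {}ha : (a.*2 <= n)%N by rewrite -[X in (_ <= X)%N]odd_double_half; lia.
have {}hb : (b.*2 <= n)%N by rewrite -[X in (_ <= X)%N]odd_double_half; lia.
nia.
Qed.

End Polytabloids.


(** * The isotypic components exhaust the space *)

Section IsotypicDecomposition.
Variables (R : realType) (n : nat).
Local Notation C := (R[i]).
Local Notation rho := (@perm_act_mx R n).
Local Notation rG := (permrep R n).
Local Notation columns x := ({ffun 'I_x -> 'I_n * 'I_n}).
Implicit Types (f g : cbasis n) (s : {perm 'I_n}) (u v w : 'rV[C]_(dimV n)).

Lemma amp_col_swap x (T : columns x) w f i :
  col_antisym T w -> amp w (precomp f (col_swap T i)) = - amp w f.
Proof. by move=> /(_ i)/(congr1 (fun u => amp u f)); rewrite amp_act ampN. Qed.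

Lemma highest_support x (T : columns x) w f :
  col_antisym T w -> w *m lowering R n = 0 ->
  (forall a b, ~~ used T a -> ~~ used T b -> w *m rho (tperm a b) = w) ->
  amp w f != 0 -> transversal T f.
Proof.
move=> anti low0 sym wf.
have half h : amp w h != 0 -> forall i, h (T i).1 != h (T i).2.
  by move=> nz i; apply: contra_neq nz => /(col_antisym0 anti).
apply/andP; split; last by apply/forallP; exact: half.
have half_f := half f wf.
apply/forallP=> b; apply/implyP=> ub; apply: contra_neqN wf => fb.
pose g := clearbit f b.
have term t : ~~ g t -> amp w (setbit g t) = if ~~ used T t then amp w f else 0.
  move=> ngt; case: ifP => [ut|/negbFE ut]; last first.
    apply/eqP; apply: contraTT ngt => nz; rewrite negbK.
    case/usedP: ut => i ti.
    have na : (T i).1 != b by apply: contraNneq ub => <-; apply/usedP; exists i; left.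
    have nb : (T i).2 != b by apply: contraNneq ub => <-; apply/usedP; exists i; right.
    move: (half _ nz i) (half_f i); rewrite /g.
    case: ti => ->; rewrite !ffunE eqxx na nb /=; case: (f _); case: (f _) => //=;
      by rewrite ?orbT.
  have [->|ntb] := eqVneq t b.
    by congr amp; apply/ffunP=> p; rewrite !ffunE; case: eqP => [->|]; rewrite ?fb.
  rewrite -[in RHS](sym b t) // amp_act; congr amp; apply/ffunP=> p.
  move: ngt; rewrite !ffunE ntb /= => /negPf nft.
  case: tpermP => [->|->|/eqP/negPf-> /eqP/negPf->//]; rewrite ?eqxx ?fb //.
  by rewrite eq_sym (negPf ntb) nft.
have := congr1 (fun u => amp u g) low0; rewrite amp_lowering amp0.
rewrite (eq_bigr _ term) -big_mkcondr /= sumr_const => /eqP.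
rewrite mulrn_eq0 => /orP[/eqP/card0_eq/(_ b)|/eqP //].
by rewrite unfold_in /= /g ffunE eqxx ub.
Qed.

(** Both vectors live on the transversals and change sign under column swaps. Swapping reduces the
    number of ones in the first row until [f0] is reached, where the polytabloid has coefficient
    1. *)
Lemma highest_vector x (T : columns x) w :
  tab_valid T -> col_antisym T w -> w *m lowering R n = 0 ->
  (forall a b, ~~ used T a -> ~~ used T b -> w *m rho (tperm a b) = w) ->
  exists c, w = c *: polytabloid R T.
Proof.
move=> vT anti low0 sym.
pose f0 : cbasis n := [ffun p => [exists i, p == (T i).2]].
exists (amp w f0); apply: ampP => f; rewrite ampZ.
have [trf|ntr] := boolP (transversal T f); last first.
  rewrite amp_polytabloid (negPf ntr) mulr0; apply/eqP.
  by apply: contraNT ntr; apply: highest_support.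
have [k] := ubnP #|[set i | f (T i).1]|; elim: k => // k IHk in f trf *.
rewrite ltnS => le_k.
have [/existsP[i fi]|] := boolP [exists i, f (T i).1]; last first.
  rewrite negb_exists => /forallP nf1; case/andP: trf => /forallP un /forallP half.
  have ff0 : f = f0.
    apply/ffunP=> p; rewrite ffunE; apply/idP/existsP=> [fp|[i /eqP->]].
      have up : used T p by apply: contraT => /(implyP (un p)); rewrite fp.
      case/usedP: up => i [] ep; last by exists i; rewrite ep.
      by have := nf1 i; rewrite -ep fp.
    by have := half i; rewrite (negPf (nf1 i)); case: (f _).
  rewrite -ff0 amp_polytabloid ifT; last by apply/andP; split; apply/forallP.
  by rewrite big1 ?mulr1 // => i _; rewrite (negPf (nf1 i)).
apply: oppr_inj; rewrite -mulrN -!(@amp_col_swap x T _ f i) //; last exact: polytabloid_antisym.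
apply: IHk.
  rewrite (transversal_amp R) amp_col_swap ?oppr_eq0 -?transversal_amp //.
  exact: polytabloid_antisym.
apply: leq_trans le_k; rewrite (cardsD1 i [set j | f (T j).1]) inE fi ltnS.
apply/subset_leq_card/subsetP=> j; rewrite !inE ffunE.
have [->|nji] := eqVneq j i; last by rewrite col_swap_other.
rewrite /col_swap tpermL; case/andP: trf => _ /forallP/(_ i).
by rewrite fi; case: (f _).
Qed.

Definition tab_cons x (ab : 'I_n * 'I_n) (T : columns x) : columns x.+1 :=
  [ffun i => if unlift ord0 i is Some j then T j else ab].

Lemma tab_cons_valid x a b (T : columns x) :
  tab_valid T -> ~~ used T a -> ~~ used T b -> a != b ->
  tab_valid (tab_cons (a, b) T).
Proof.
move=> /tab_validP[inj1 inj2 ne12] ua ub ab.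
have na i : ((T i).1 != a) * ((T i).2 != a).
  by split; apply: contraNneq ua => <-; apply/usedP; exists i; [left|right].
have nb i : ((T i).1 != b) * ((T i).2 != b).
  by split; apply: contraNneq ub => <-; apply/usedP; exists i; [left|right].
apply/tab_validP; split=> i j; rewrite !ffunE.
- case: (unliftP ord0 i) => [i' ->|->]; case: (unliftP ord0 j) => [j' ->|->] //=.
  + by move/inj1->.
  + by move/eqP; rewrite (negPf (na _).1).
  + by move/eqP; rewrite eq_sym (negPf (na _).1).
- case: (unliftP ord0 i) => [i' ->|->]; case: (unliftP ord0 j) => [j' ->|->] //=.
  + by move/inj2->.
  + by move/eqP; rewrite (negPf (nb _).2).
  + by move/eqP; rewrite eq_sym (negPf (nb _).2).
- case: (unliftP ord0 i) => [i' _|_]; case: (unliftP ord0 j) => [j' _|_] //=.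
  + by rewrite (nb _).1.
  + by rewrite eq_sym (na _).2.
Qed.

(* Antisymmetrise in disjoint pairs of sites as long as the result is nonzero;
   the vector obtained is then symmetric in the remaining sites. *)
Lemma polytabloid_in_module (M : 'M[C]_(dimV n)) x (T : columns x) w :
  mxmodule rG M -> (w <= M)%MS -> w != 0 -> w *m lowering R n = 0 ->
  tab_valid T -> col_antisym T w ->
  exists y (T' : columns y), tab_valid T' /\ (polytabloid R T' <= M)%MS.
Proof.
(* Each new column lowers [n - x], and [tab_size] bounds the number of columns, so the process
   stops. *)
move=> modM; have [k] := ubnP (n - x); elim: k => // k IHk in x T w *.
rewrite ltnS => le_k wM nzw low0 vT anti.
have modMs v s : (v <= M)%MS -> (v *m rho s <= M)%MS.
  by move=> vM; apply: submx_trans (submxMr _ vM) (mxmoduleP modM s (in_setT _)).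
have [/existsP[a /existsP[b /and3P[ua ub nsym]]]|] :=
  boolP [exists a, exists b, [&& ~~ used T a, ~~ used T b & w *m rho (tperm a b) != w]].
  have ab : a != b by apply: contraNneq nsym => ->; rewrite tperm1 perm_act1 mulmx1.
  have vT' := tab_cons_valid vT ua ub ab.
  apply: (IHk x.+1 (tab_cons (a, b) T) (w - w *m rho (tperm a b))) => //.
  - by have := tab_size vT'; lia.
  - by rewrite addmx_sub ?eqmx_opp ?modMs.
  - by rewrite subr_eq0 eq_sym.
  - by rewrite mulmxBl low0 -mulmxA lowering_comm mulmxA low0 mul0mx subr0.
  (* The new vector changes sign under the swap of [a] and [b]. It stays antisymmetric in the old
     columns, whose swaps are disjoint from this one and commute with it. *)
  move=> i; rewrite /col_swap ffunE; case: (unliftP ord0 i) => [j _|_] /=.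
    rewrite mulmxBl -mulmxA -perm_actM tperm_disjoint_comm; first last.
    - by apply: contraNneq ub => ->; apply/usedP; exists j; right.
    - by apply: contraNneq ub => ->; apply/usedP; exists j; left.
    - by apply: contraNneq ua => ->; apply/usedP; exists j; right.
    - by apply: contraNneq ua => ->; apply/usedP; exists j; left.
    by rewrite perm_actM mulmxA (anti j) mulNmx opprB opprK addrC.
  by rewrite mulmxBl -mulmxA -perm_actM tperm2 perm_act1 mulmx1 opprB.
rewrite negb_exists => /forallP sym.
have [c wE] : exists c, w = c *: polytabloid R T.
  apply: highest_vector => // a b ua ub; apply/eqP.
  have := sym a; rewrite negb_exists => /forallP/(_ b).
  by rewrite ua ub /= negbK.
exists x, T; split=> //.
have nzc : c != 0 by apply: contraNneq nzw => c0; rewrite wE c0 scale0r.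
by rewrite -[polytabloid R T](scalerK nzc) scalemx_sub // -wE.
Qed.

Lemma specht_module x : mxmodule rG (specht R n x).
Proof.
apply/mxmoduleP=> s _; rewrite (eqmxMr _ (genmxE _)) genmxE.
apply/row_subP=> r; rewrite row_mul rowK; case: ifP => [vT|_]; last by rewrite mul0mx sub0mx.
rewrite [_ *m _]polytabloid_act.
apply: (eq_row_sub (enum_rank (col_act (enum_val r) s))).
by rewrite rowK enum_rankK col_act_valid.
Qed.

Lemma polytabloid_specht x (T : columns x) :
  tab_valid T -> (polytabloid R T <= specht R n x)%MS.
Proof.
move=> vT; rewrite genmxE; apply: (eq_row_sub (enum_rank T)).
by rewrite rowK enum_rankK vT.
Qed.

Lemma polytabloid_neq0 x (T : columns x) : tab_valid T -> polytabloid R T != 0.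
Proof.
case/tab_validP=> inj1 inj2 ne12.
pose f0 : cbasis n := [ffun p => [exists i, p == (T i).2]].
have tr0 : transversal T f0.
  apply/andP; split; apply/forallP=> i.
    rewrite ffunE; apply/implyP; apply: contraNN => /existsP[j /eqP ->].
    by apply/usedP; exists j; right.
  rewrite !ffunE; have -> : [exists j, (T i).2 == (T j).2] by apply/existsP; exists i.
  by rewrite eqb_id; apply/existsP=> -[j]; rewrite (negPf (ne12 i j)).
apply/eqP => /(congr1 (fun u => amp u f0)); rewrite amp0 amp_polytabloid tr0.
by move/eqP; rewrite prodf_seq_eq0 => /hasP[i _]; rewrite signr_eq0 andbF.
Qed.

(** Induction on a bound for the number of ones in [u]. If lowering kills [u], then [M] contains a
    polytabloid, hence its Specht module, and equals it by minimality. Otherwise lowering is a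
    module homomorphism, injective on [M] by Schur, and the image of [u] has fewer ones. *)
Lemma simple_iso_specht (M : 'M[C]_(dimV n)) u k :
  mxsimple rG M -> (u <= M)%MS -> u != 0 ->
  (forall f, amp u f != 0 -> (#|[set p | f p]| < k)%N) ->
  exists x : 'I_(n./2).+1, mx_iso rG (specht R n x) M.
Proof.
elim: k M u => [|k IHk] M u simM uM nzu supp.
  case/eqP: nzu; apply: ampP => f; rewrite amp0; apply/eqP.
  by apply: contraT => /supp.
have [modM _ minM] := simM.
have [low0|nlow] := eqVneq (u *m lowering R n) 0.
  have T0 : columns 0 by apply: finfun => -[].
  have vT0 : tab_valid T0 by apply/forallP=> -[].
  have [y [T [vT TM]]] : exists y (T : columns y), tab_valid T /\ (polytabloid R T <= M)%MS.
    by apply: (polytabloid_in_module modM uM nzu low0 vT0) => -[].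
  have ley : (y < (n./2).+1)%N by have := tab_size vT; lia.
  exists (Ordinal ley); apply: eqmx_iso; apply/eqmxP.
  have SM : (specht R n y <= M)%MS.
    rewrite genmxE; apply/row_subP=> r; rewrite rowK; case: ifP => [vT'|_]; last exact: sub0mx.
    have [s <-] := col_act_transitive vT vT'; rewrite -polytabloid_act.
    by apply: submx_trans (submxMr _ TM) (mxmoduleP modM s (in_setT _)).
  rewrite SM; apply: minM (specht_module _) SM _.
  apply: contraNneq (polytabloid_neq0 vT) => S0.
  by rewrite -submx0 -S0 polytabloid_specht.
have homL : (M <= dom_hom_mx rG (lowering R n))%MS.
  by apply/hom_mxP=> s _; rewrite -!mulmxA [rG s *m _]lowering_comm.
have nzML : M *m lowering R n != 0.
  by apply: contraNneq nlow => ML0; rewrite -submx0 -ML0 submxMr.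
have isoML := mx_Schur_inj_iso simM homL nzML.
have [x isox] : exists x : 'I_(n./2).+1, mx_iso rG (specht R n x) (M *m lowering R n).
  apply: (IHk _ (u *m lowering R n)) => //.
  - exact: mx_iso_simple isoML simM.
  - exact: submxMr.
  (* A word with at least [k] ones receives amplitude only from words with more than [k] ones, where
     [u] vanishes. *)
  move=> g; apply: contraR; rewrite -leqNgt => lekg.
  rewrite amp_lowering big1 // => t ngt; apply/eqP; apply: contraTT lekg => /supp.
  rewrite -ltnNge ltnS => le_k; apply: leq_trans le_k.
  have -> : [set p | setbit g t p] = t |: [set p | g p] by apply/setP=> p; rewrite !inE ffunE.
  by rewrite cardsU1 inE ngt.
by exists x; apply: mx_iso_trans isox (mx_iso_sym isoML).
Qed.

(** Maschke in characteristic 0 splits the space into simple modules, each of which lies in the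
    component of the Specht module isomorphic to it. *)
Lemma isotypic_sum : (1%:M <= \sum_(x < (n./2).+1) isotypic R n x)%MS.
Proof.
have maschke : mx_completely_reducible rG 1%:M.
  apply: mx_Maschke_pchar.
  by rewrite /pgroup.pgroup pcharf'_nat pnatr_eq0 -lt0n cardG_gt0.
apply: (mx_reducible_semisimple (mxmodule1 _) maschke) => -[I W V simW <- _].
apply/sumsmx_subP=> i _; have simWi := simW i; have [_ nzW _] := simWi.
have [x isox] : exists x : 'I_(n./2).+1, mx_iso rG (specht R n x) (W i).
  apply: (@simple_iso_specht _ (nz_row (W i)) n.+1) => //.
  - exact: nz_row_sub.
  - by rewrite nz_row_eq0.
  - by move=> f _; rewrite ltnS -[leqRHS](card_ord n) max_card.
rewrite (sumsmx_sup x) //; apply: mx_iso_component (isox).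
exact: mx_iso_simple (mx_iso_sym isox) simWi.
Qed.

End IsotypicDecomposition.


(** * Mean and variance of the Casimir operator in the state [Xi] *)

Section DickeState.
Variables (R : realType) (l b M N : nat).
Local Notation C := (R[i]).
Local Notation k := (l + b)%N.
Local Notation n := (l + b + M + N)%N.
Local Notation m := (l + M)%N.
Implicit Types (f g : cbasis n) (i j p : 'I_n).

Definition frozen_bit f p :=
  ((p < l)%N ==> f p) && (((l <= p) && (p < k))%N ==> ~~ f p).
Definition Xi_supp f :=
  [forall p, frozen_bit f p] && (#|[set p : 'I_n | (k <= p)%N && f p]| == M).
Local Notation S := Xi_supp.

Definition Xi_coef : R := (Num.sqrt ('C(M + N, M)%:R : R))^-1.

(** With block sizes [l] (frozen ones), [b] (frozen zeros), [M] (tail ones) and [N] (tail zeros),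
    the truncated subtractions in [Xi] evaluate to [M] and [N]. *)
Lemma amp_Xi f : amp (Xi R n m k l) f = if S f then (Xi_coef%:C)%C else 0.
Proof.
rewrite /amp mxE enum_rankK addKn.
by have -> : (n + l - (m + k) = N)%N by lia.
Qed.

Lemma sum_bool_card (P : pred 'I_n) : (\sum_i P i = #|[set i | P i]|)%N.
Proof. by rewrite -sum1dep_card [RHS]big_mkcond; apply: eq_bigr => i _; case: (P i). Qed.

Lemma count_lt a : (a <= n)%N -> (\sum_(i < n) (i < a) = a)%N.
Proof.
move=> le_a; transitivity (\sum_(i < n | (i < a)%N) 1)%N.
  by rewrite [RHS]big_mkcond; apply: eq_bigr => i _; case: (_ < _)%N.
by rewrite (big_ord_narrow le_a) sum1_card card_ord.
Qed.

Lemma frozen_bit_ones f : [forall p, frozen_bit f p] ->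
  (\sum_(p < n) ((p < k)%N && f p) = l)%N.
Proof.
move/forallP=> fr; rewrite -[RHS]count_lt; last by lia.
apply: eq_bigr => p _; have := fr p; rewrite /frozen_bit.
case: (ltnP p l) => pl /=; last by case: (p < k)%N => //= /negPf->.
by rewrite andbT => ->; rewrite (leq_trans pl) ?leq_addr.
Qed.

Lemma frozen_bit_zeros f : [forall p, frozen_bit f p] ->
  (\sum_(p < n) ((p < k)%N && ~~ f p) = b)%N.
Proof.
move=> fr; apply: (@addnI l); rewrite -{1}(frozen_bit_ones fr) -big_split /=.
rewrite -[RHS]count_lt; last by lia.
by apply: eq_bigr => p _; case: (p < k)%N; case: (f p).
Qed.

Lemma ones_frozen f : [forall p, frozen_bit f p] ->
  (\sum_(p < n) f p = l + #|[set p : 'I_n | (k <= p)%N && f p]|)%N.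
Proof.
move=> fr; transitivity (\sum_(p < n) ((p < k) && f p) + \sum_(p < n) ((k <= p) && f p))%N.
  by rewrite -big_split; apply: eq_bigr => p _; case: ltnP => _; case: (f p).
by rewrite frozen_bit_ones // sum_bool_card.
Qed.

Lemma zeros_tail f : S f -> (\sum_(p < n) ((k <= p)%N && ~~ f p) = N)%N.
Proof.
case/andP=> fr /eqP cM; have n_k : (\sum_(p < n) (p < k) = k)%N by rewrite count_lt //; lia.
have : (\sum_(p < n) (p < n) = n)%N by rewrite count_lt.
have -> : (\sum_(p < n) (p < n) = \sum_(p < n) (p < k) +
    (\sum_(p < n) ((k <= p)%N && f p) + \sum_(p < n) ((k <= p)%N && ~~ f p)))%N.
  rewrite -!big_split /=; apply: eq_bigr => p _; rewrite ltn_ord.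
  by case: ltnP => _; case: (f p).
by rewrite n_k sum_bool_card cM; lia.
Qed.

Lemma card_Xi_supp : #|[set f | S f]| = 'C(M + N, M).
Proof.
pose tail f := [set p : 'I_n | (k <= p)%N && f p].
pose B := [set p : 'I_n | (k <= p)%N].
have cardB : #|B| = (M + N)%N.
  have := @count_lt n (leqnn _); rewrite -sum_bool_card.
  have : (\sum_(p < n) (p < k) = k)%N by rewrite count_lt //; lia.
  have -> : (\sum_(p < n) (p < n) = \sum_(p < n) (p < k) + \sum_(p < n) (k <= p))%N.
    by rewrite -big_split /=; apply: eq_bigr => p _; rewrite ltn_ord; case: ltnP.
  by move=> -> e; apply: (@addnI k); rewrite addnA; exact: e.
rewrite -cardB -cards_draws -(@card_in_imset _ _ tail).
  apply: eq_card => A; rewrite inE; apply/imsetP/andP=> [[f]|[sAB /eqP cA]].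
    rewrite inE => /andP[_ cM] ->; split=> //.
    by apply/subsetP=> p; rewrite !inE => /andP[].
  pose f : cbasis n := [ffun p : 'I_n => (p < l)%N || (p \in A)].
  have tailf : tail f = A.
    apply/setP=> p; rewrite inE ffunE.
    have := subsetP sAB p; rewrite inE; case: (p \in A) => [-> //|_]; first by rewrite orbT.
    by case: leqP => //= kp; lia.
  exists f => //; rewrite inE; apply/andP; split; last by rewrite -/(tail f) tailf cA.
  apply/forallP=> p; rewrite /frozen_bit ffunE.
  have := subsetP sAB p; rewrite inE; case: (p \in A) => [/(_ isT)|_].
    by rewrite orbT implybT /=; lia.
  by rewrite orbF; case: ltnP => _ /=; rewrite ?implybT.
move=> f g; rewrite !inE => /andP[/forallP ff _] /andP[/forallP fg _] /setP etail.
apply/ffunP=> p; have := etail p; have := ff p; have := fg p; rewrite !inE /frozen_bit.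
case: (leqP k p) => //= kp; case: (ltnP p l) => pl /=; first by rewrite !andbT => -> ->.
by move=> /negPf-> /negPf->.
Qed.

(** A swap leaves the support exactly when the two bits differ and at least one site is frozen. The
    1 and the 0 are then both frozen ([l * b]), or only the 1 is ([l * N]), or only the 0 is
    ([M * b]); ordering the pair doubles the count. The result does not depend on [f]. *)
Lemma Xi_supp_swaps f : S f ->
  (\sum_i \sum_j ~~ S (precomp f (tperm i j)) = 2 * (l * b + l * N + M * b))%N.
Proof.
move=> Sf; have /andP[fr /eqP cM] := Sf.
have out i j : ~~ S (precomp f (tperm i j)) =
    (f i != f j) && ((i < k)%N || (j < k)%N).
  have [eq_f|ne_f] /= := eqVneq (f i) (f j); first by rewrite precomp_tperm_id // Sf.
  rewrite /S; case: ltnP => ik /=; [|case: ltnP => jk /=].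
  - rewrite negb_and; apply/orP; left; rewrite negb_forall; apply/existsP; exists i.
    have := forallP fr i; rewrite /frozen_bit ffunE tpermL ik andbT.
    by case: ltnP => _ /=; move: ne_f; case: (f i); case: (f j).
  - rewrite negb_and; apply/orP; left; rewrite negb_forall; apply/existsP; exists j.
    have := forallP fr j; rewrite /frozen_bit ffunE tpermR jk andbT.
    by case: ltnP => _ /=; move: ne_f; case: (f i); case: (f j).
  apply/negbTE; rewrite negbK; apply/andP; split.
    apply/forallP=> p; have := forallP fr p; rewrite /frozen_bit ffunE.
    by case: tpermP => // ->; rewrite ?(leq_gtF ik) ?(leq_gtF jk) ?andbF ?implybT //=;
      rewrite !ltnNge ?(leq_trans (leq_addr _ _) ik) ?(leq_trans (leq_addr _ _) jk).
  apply/eqP; rewrite -[RHS]cM -(card_imset _ (@perm_inj _ (tperm i j))); apply/eq_card => p.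
  rewrite inE ffunE; apply/andP/imsetP=> [[kp fp]|[q]].
    exists (tperm i j p); rewrite ?tpermK // inE fp andbT.
    by case: tpermP.
  rewrite inE => /andP[kq fq] ->; rewrite tpermK; split=> //.
  by case: tpermP.
pose o1 p : nat := (p < k)%N && f p; pose o2 p : nat := (k <= p)%N && f p.
pose z1 p : nat := (p < k)%N && ~~ f p; pose z2 p : nat := (k <= p)%N && ~~ f p.
have prod_sum (F G : 'I_n -> nat) : (\sum_i \sum_j F i * G j = (\sum_i F i) * (\sum_j G j))%N.
  by rewrite big_distrl; apply: eq_bigr => i _; rewrite big_distrr.
transitivity (\sum_i \sum_j (o1 i * z1 j + o1 i * z2 j + o2 i * z1 j
                          + (z1 i * o1 j + z2 i * o1 j + z1 i * o2 j)))%N.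
  apply: eq_bigr => i _; apply: eq_bigr => j _; rewrite out /o1 /o2 /z1 /z2.
  by case: ltnP => _; case: ltnP => _; case: (f i); case: (f j).
under eq_bigr do rewrite !big_split /=.
rewrite !big_split /= !prod_sum /o1 /o2 /z1 /z2.
rewrite frozen_bit_ones // frozen_bit_zeros // zeros_tail // sum_bool_card cM.
lia.
Qed.

(* If f is outside the support because of a wrong bit p < k, every swap that
   brings f into the support involves p. *)
Lemma Xi_nsupp_swaps f : ~~ S f ->
  (\sum_i \sum_j S (precomp f (tperm i j)) <= 2 * n)%N.
Proof.
move=> nSf; have [fr|] := boolP [forall p, frozen_bit f p].
  (* With all frozen bits right, [f] misses the support by its total number of ones, which no swap
     changes. *)
  rewrite big1 // => i _; rewrite big1 // => j _; apply/eqP; rewrite eqb0.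
  apply: contra nSf; rewrite /S fr /= => /andP[fr' /eqP cM].
  apply/eqP/(@addnI l); rewrite -[LHS](ones_frozen fr).
  transitivity (\sum_(p < n) precomp f (tperm i j) p)%N; last by rewrite (ones_frozen fr') cM.
  rewrite [LHS](reindex_inj (@perm_inj _ (tperm i j))) /=.
  by apply: eq_bigr => p _; rewrite ffunE.
rewrite negb_forall => /existsP[p wrong].
apply: (@leq_trans (\sum_i \sum_j ((i == p) + (j == p)))).
  apply: leq_sum => i _; apply: leq_sum => j _.
  case: (boolP (S _)) => // /andP[/forallP/(_ p) frp _].
  have [//|nip] := eqVneq i p; have [//|njp] := eqVneq j p.
  by case/negP: wrong; move: frp; rewrite /frozen_bit ffunE tpermD.
have one : (\sum_(j < n) (j == p) = 1)%N.
  by rewrite (bigD1 p) //= eqxx big1 // => j /negPf->.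
under eq_bigr do rewrite big_split /= one sum_nat_const card_ord.
by rewrite big_split /= sum_nat_const card_ord -big_distrr /= one; lia.
Qed.

Lemma sqnorm_amp (v : 'rV[C]_(dimV n)) (r : cbasis n -> R) :
  (forall f, amp v f = ((r f)%:C)%C) -> sqnorm v = \sum_f r f ^+ 2.
Proof.
move=> vr; rewrite sqnormE (reindex_onto enum_rank enum_val) /=; last first.
  by move=> j _; rewrite enum_valK.
apply: eq_big => [f|f _]; first by rewrite enum_rankK eqxx.
by have := vr f; rewrite /amp => -> /=; rewrite expr0n addr0.
Qed.

Lemma Xi_coef_sq : Xi_coef ^+ 2 * 'C(M + N, M)%:R = 1.
Proof.
rewrite /Xi_coef exprVn sqr_sqrtr ?ler0n // mulVf // pnatr_eq0 -lt0n.
by rewrite bin_gt0 leq_addr.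
Qed.

Lemma sqnorm_Xi : sqnorm (Xi R n m k l) = 1.
Proof.
rewrite (@sqnorm_amp _ (fun f => Xi_coef * (S f)%:R)); last first.
  by move=> f; rewrite amp_Xi; case: (S f); rewrite ?mulr1 ?mulr0.
rewrite -[RHS]Xi_coef_sq -card_Xi_supp -sum1dep_card natr_sum mulr_sumr big_mkcond /=.
rewrite [RHS]big_mkcond; apply: eq_bigr => f _.
by case: (S f); rewrite /= ?mulr1 ?mulr0 ?expr0n.
Qed.

(** The expectation of the Casimir operator in [Xi]. *)
Definition Xi_mean : nat := (2 * (l * b + l * N + M * b))%N.

(** On the support the shifted vector vanishes, since each word has exactly [Xi_mean] outgoing
    swaps. Off the support its amplitude is [- Xi_coef] times the number [d f] of swaps entering the
    support, and [d f ^ 2 <= 2 n * d f]. *)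
Lemma casimir_variance :
  sqnorm (Xi R n m k l *m casimir R n - ((Xi_mean%:R)%:C)%C *: Xi R n m k l)
    <= (2 * n * Xi_mean)%:R.
Proof.
pose d f := (\sum_i \sum_j S (precomp f (tperm i j)))%N.
pose r f := Xi_coef * (if S f then 0 else - (d f)%:R).
rewrite (@sqnorm_amp _ r) => [|f]; last first.
  rewrite ampD ampN ampZ amp_casimir /r.
  have -> : \sum_i \sum_j (amp (Xi R n m k l) f - amp (Xi R n m k l) (precomp f (tperm i j)))
     = \sum_i \sum_j (Xi_coef%:C)%C * ((S f)%:R - (S (precomp f (tperm i j)))%:R).
    apply: eq_bigr => i _; apply: eq_bigr => j _; rewrite !amp_Xi.
    by case: (S f); case: (S _) => /=; ring.
  under eq_bigr do rewrite -mulr_sumr.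
  rewrite -mulr_sumr amp_Xi; have [Sf|nSf] := boolP (S f).
    rewrite mulr0.
    have -> : \sum_i \sum_j (true%:R - (S (precomp f (tperm i j)))%:R)
        = Xi_mean%:R :> C.
      rewrite -(Xi_supp_swaps Sf : _ = Xi_mean) natr_sum; apply: eq_bigr => i _.
      rewrite natr_sum; apply: eq_bigr => j _.
      by case: (S _); rewrite ?subrr ?subr0.
    by rewrite rmorph_nat mulrC subrr.
  have -> : \sum_i \sum_j (false%:R - (S (precomp f (tperm i j)))%:R) = - (d f)%:R :> C.
    rewrite natr_sum -sumrN; apply: eq_bigr => i _.
    by rewrite natr_sum -sumrN; apply: eq_bigr => j _; rewrite sub0r.
  by rewrite mulr0 subr0 rmorphM rmorphN rmorph_nat.
(* Double counting: swaps are involutions, so as many enter the support as leave it. *)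
have dsum : (\sum_(f | ~~ S f) d f = #|[set f | S f]| * Xi_mean)%N.
  have exch (F : cbasis n -> 'I_n -> 'I_n -> nat) (P : pred (cbasis n)) :
      (\sum_(f | P f) \sum_i \sum_j F f i j = \sum_i \sum_j \sum_(f | P f) F f i j)%N.
    by rewrite exchange_big; apply: eq_bigr => i _; rewrite exchange_big.
  rewrite exch -sum_nat_const (eq_bigl S) => [|f]; last by rewrite inE.
  transitivity (\sum_(f | S f) \sum_i \sum_j ~~ S (precomp f (tperm i j)))%N; last first.
    by apply: eq_bigr => f Sf; rewrite Xi_supp_swaps.
  rewrite exch; apply: eq_bigr => i _; apply: eq_bigr => j _.
  have swapK : involutive (fun f => precomp f (tperm i j)).
    by move=> f; apply/ffunP=> p; rewrite !ffunE tpermK.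
  rewrite (reindex_inj (inv_inj swapK)) /= big_mkcond [RHS]big_mkcond.
  by apply: eq_bigr => f _; rewrite swapK; case: (S f); case: (S _).
have -> : \sum_f r f ^+ 2 = Xi_coef ^+ 2 * (\sum_(f | ~~ S f) d f ^ 2)%:R.
  rewrite natr_sum mulr_sumr big_mkcond [RHS]big_mkcond; apply: eq_bigr => f _.
  by rewrite /r; case: (S f); rewrite ?mulr0 ?expr0n // exprMn sqrrN natrX.
have -> : (2 * n * Xi_mean)%:R = Xi_coef ^+ 2 * (2 * n * (#|[set f | S f]| * Xi_mean))%:R :> R.
  by rewrite card_Xi_supp [in RHS]mulnCA [in RHS]natrM [RHS]mulrA Xi_coef_sq mul1r.
rewrite ler_wpM2l ?sqr_ge0 // ler_nat -dsum big_distrr /=.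
by apply: leq_sum => f nSf; rewrite expnS expn1 leq_mul // Xi_nsupp_swaps.
Qed.

End DickeState.


(** * Chebyshev bounds for the distribution of [X] *)

Section Concentration.
Variable R : realType.

Lemma pmf_sqnorm n m k l x :
  pmf R n m k l x = sqnorm (Xi R n m k l *m orth_proj (isotypic R n x)).
Proof. exact: sqnorm_orth_proj. Qed.

Lemma pmf_ge0 n m k l x : 0 <= pmf R n m k l x.
Proof. by rewrite pmf_sqnorm sqnorm_ge0. Qed.

Lemma sum_pmf n m k l : \sum_(x < n./2.+1) pmf R n m k l x = sqnorm (Xi R n m k l).
Proof.
under eq_bigr do rewrite pmf_sqnorm.
apply/esym; apply: (@sqnorm_sum_orth_proj _ _ _ (casimir R n)
  (fun x : 'I__ => isotypic R n x) (fun x => casimir_ev n x)).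
- exact: adjmx_casimir.
- by move=> x; exact: isotypic_eigen.
- exact: casimir_ev_inj.
- exact: isotypic_sum.
Qed.

Lemma casimir_moment n m k l (c : R) :
  \sum_(x < n./2.+1) ((casimir_ev n x)%:R - c) ^+ 2 * pmf R n m k l x
    = sqnorm (Xi R n m k l *m casimir R n - (c%:C)%C *: Xi R n m k l).
Proof.
under eq_bigr do rewrite pmf_sqnorm.
apply/esym; apply: (@sqnorm_shift _ _ _ (casimir R n)
  (fun x : 'I__ => isotypic R n x) (fun x => casimir_ev n x)).
- exact: adjmx_casimir.
- by move=> x; exact: isotypic_eigen.
- exact: casimir_ev_inj.
- exact: isotypic_sum.
Qed.

(** With [x = t n] the difference is [2 n^2 (t - mu)(1 - t - mu) + 2 t n], and
    [1 - t - mu >= |t - mu|] since both numbers are at most 1/2. For [t < mu] the last term has the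
    wrong sign, but it is at most [n <= eps^2 n^2], half of the main bound [2 eps^2 n^2]. *)
Lemma casimir_deviation (n x mu eps : R) :
  0 < n -> 0 <= x -> 2 * x <= n -> mu <= 1 / 2 -> 0 < eps -> 1 <= eps ^+ 2 * n ->
  eps < `|x / n - mu| ->
  (eps ^+ 2 * n ^+ 2) ^+ 2 <= (2 * (x * (n - x + 1)) - 2 * n ^+ 2 * (mu * (1 - mu))) ^+ 2.
Proof.
move=> n0 x0 x2 mu2 e0 ne dev.
have [t xE] : exists t, x = t * n by exists (x / n); rewrite divfK ?gt_eqF.
rewrite xE mulfK ?gt_eqF // in dev; rewrite xE in x0 x2 *.
have t0 : 0 <= t by rewrite -(pmulr_lge0 _ n0).
have t2 : t <= 1 / 2 by rewrite -(ler_pM2r n0); lra.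
have e2 : 0 <= eps ^+ 2 * n ^+ 2 by rewrite mulr_ge0 ?sqr_ge0.
have n2 : 0 <= n ^+ 2 by exact: sqr_ge0.
have key (a b : R) : eps < a -> a <= b -> eps ^+ 2 <= a * b.
  by move=> ea ab; rewrite expr2 ler_pM //; lra.
move: dev; rewrite lter_normr => /orP[dev|dev].
  have K := key (t - mu) (1 - t - mu) dev ltac:(lra).
  rewrite ler_sqr ?nnegrE //; last first.
    nra.
  nra.
have K := key (mu - t) (1 - t - mu) ltac:(lra) ltac:(lra).
rewrite -[leRHS]sqrrN ler_sqr ?nnegrE //.
  nra.
nra.
Qed.

(** Chebyshev: a deviation forces the squared Casimir difference above [K], and
    [n^3 / K = 1 / (eps^4 n)]. *)
Lemma dev_prob_bound n m k l (mu eps : R) :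
  (0 < n)%N -> 0 <= mu -> mu <= 1 / 2 -> 0 < eps -> 1 <= eps ^+ 2 * n%:R ->
  \sum_(x < n./2.+1) ((casimir_ev n x)%:R - 2 * n%:R ^+ 2 * (mu * (1 - mu))) ^+ 2
      * pmf R n m k l x <= n%:R ^+ 3 ->
  dev_prob n m k l mu eps <= (eps ^+ 4 * n%:R)^-1.
Proof.
move=> n0 mu0 mu2 e0 ne moment; have n0R : 0 < n%:R :> R by rewrite ltr0n.
pose K : R := (eps ^+ 2 * n%:R ^+ 2) ^+ 2.
have K0 : 0 < K by rewrite !(exprn_gt0, mulr_gt0).
have -> : (eps ^+ 4 * n%:R)^-1 = n%:R ^+ 3 / K.
  by rewrite /K; field; rewrite !gt_eqF.
rewrite ler_pdivlMr //; apply: le_trans moment.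
rewrite /dev_prob mulr_suml big_mkcond /=; apply: ler_sum => x _.
case: ifP => dev; last by rewrite mulr_ge0 ?sqr_ge0 ?pmf_ge0.
rewrite mulrC ler_wpM2r ?pmf_ge0 //.
have lex : (x.*2 <= n)%N.
  by have := ltn_ord x; have := odd_double_half n; lia.
have -> : (casimir_ev n x)%:R = 2 * (x%:R * (n%:R - x%:R + 1)) :> R.
  by rewrite /casimir_ev !natrM -[(n - x).+1%:R]natr1 natrB //; lia.
apply: casimir_deviation dev => //.
by rewrite -natrM ler_nat mul2n.
Qed.

Lemma Xi_concentration (alpha beta gamma delta mu : R) n m k l :
  0 <= alpha -> 0 <= beta -> 0 <= gamma -> 0 <= delta ->
  alpha + beta + gamma + delta = 1 ->
  mu * (1 - mu) = alpha * gamma + alpha * delta + beta * gamma ->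
  l%:R = alpha * n%:R -> m%:R = (alpha + beta) * n%:R ->
  k%:R = (alpha + gamma) * n%:R ->
  \sum_(x < n./2.+1) pmf R n m k l x = 1 /\
  \sum_(x < n./2.+1) ((casimir_ev n x)%:R - 2 * n%:R ^+ 2 * (mu * (1 - mu))) ^+ 2
      * pmf R n m k l x <= n%:R ^+ 3.
Proof.
move=> a0 b0 c0 d0 sum1 mu_eq lE mE kE.
have n0 : 0 <= n%:R :> R by rewrite ler0n.
(* Nonnegativity of the four parameters provides the inequalities under which the natural-number
   subtractions are exact. *)
have lm : (l <= m)%N by rewrite -(ler_nat R) lE mE; nra.
have lk : (l <= k)%N by rewrite -(ler_nat R) lE kE; nra.
have mkn : (m + k <= n + l)%N by rewrite -(ler_nat R) !natrD lE mE kE; nra.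
have [b kb] : exists b, k = (l + b)%N by exists (k - l)%N; lia.
have [M mM] : exists M, m = (l + M)%N by exists (m - l)%N; lia.
have [N nN] : exists N, n = (l + b + M + N)%N by exists (n + l - (m + k))%N; lia.
have bE : b%:R = gamma * n%:R by move: kE; rewrite kb natrD; lra.
have ME : M%:R = beta * n%:R by move: mE; rewrite mM natrD; lra.
have NE : N%:R = delta * n%:R.
  have : n%:R = l%:R + b%:R + M%:R + N%:R :> R by rewrite {1}nN !natrD.
  rewrite lE bE ME => e; have := congr1 (fun z => z * n%:R) sum1; lra.
have meanE : (Xi_mean l b M N)%:R = 2 * n%:R ^+ 2 * (mu * (1 - mu)).
  by rewrite mu_eq /Xi_mean !(natrM, natrD) lE bE ME NE; ring.
(* The variance bound is [4 n^3 mu (1 - mu)], and [mu (1 - mu) <= 1/4]. *)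
have mean_le : (2 * n * Xi_mean l b M N)%:R <= n%:R ^+ 3 :> R.
  rewrite natrM meanE natrM.
  have mu4 : mu * (1 - mu) <= 1 / 4 by have := sqr_ge0 (mu - 1 / 2); lra.
  have n3 : 0 <= n%:R ^+ 3 :> R by exact: exprn_ge0.
  nra.
split; first by rewrite sum_pmf mM kb nN sqnorm_Xi.
rewrite casimir_moment -meanE; apply: le_trans mean_le.
rewrite mM kb nN; exact: casimir_variance.
Qed.

(** [|X/n - mu|] is at most [eps] off the deviation event and at most 1 on it; total mass 1 allows
    [n mu] to be absorbed into the sum. *)
Lemma expectation_bound n m k l (mu eps : R) :
  0 <= mu -> mu <= 1 / 2 -> 0 < eps -> (0 < n)%N ->
  \sum_(x < n./2.+1) pmf R n m k l x = 1 ->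
  `| expectation R n m k l - n%:R * mu | <= n%:R * (eps + dev_prob n m k l mu eps).
Proof.
move=> mu0 mu2 e0 n0 sum1; have n0R : 0 < n%:R :> R by rewrite ltr0n.
have mean1 (c : R) : c = \sum_(x < n./2.+1) c * pmf R n m k l x.
  by rewrite -mulr_sumr sum1 mulr1.
rewrite [n%:R * mu]mean1 /expectation -sumrB.
apply: le_trans (ler_norm_sum _ _ _) _.
rewrite mulrDr [n%:R * eps]mean1 /dev_prob mulr_sumr.
rewrite [X in _ + X]big_mkcond -big_split /=; apply: ler_sum => x _.
have p0 := pmf_ge0 n m k l x; rewrite -mulrBl normrM (ger0_norm p0).
have lex : (x.*2 <= n)%N.
  by have := ltn_ord x; have := odd_double_half n; lia.
have xE : x%:R - n%:R * mu = n%:R * (x%:R / n%:R - mu).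
  by rewrite mulrBr mulrCA divff ?mulr1 // gt_eqF.
have t2 : x%:R / n%:R <= 1 / 2 :> R.
  have : 2 * x%:R <= n%:R :> R by rewrite -natrM ler_nat mul2n.
  by rewrite ler_pdivrMr //; lra.
have t0 : 0 <= x%:R / n%:R :> R by rewrite divr_ge0.
rewrite xE normrM (ger0_norm (ltW n0R)); case: ltP => [dev|le_eps].
  rewrite -mulrDl ler_wpM2r // -[X in _ <= _ + X]mulr1 -mulrDr ler_wpM2l ?ltW //.
  rewrite ltr_norml; apply/andP; split; lra.
by rewrite addr0 ler_wpM2r // ler_wpM2l.
Qed.

End Concentration.

(** * The limit along admissible [n] *)

Theorem theorem5p6 (R : realType) (alpha beta gamma delta : R) :
  0 <= alpha -> 0 <= beta -> 0 <= gamma -> 0 <= delta ->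
  alpha + beta + gamma + delta = 1 ->
  let D := 1 - 4 * (alpha * gamma + alpha * delta + beta * gamma) in
  let mu := (1 - Num.sqrt D) / 2 in
  (* Pr_n[ |X/n - mu| > eps ] -> 0 along admissible n *)
  (forall eps : R, 0 < eps ->
   forall eta : R, 0 < eta ->
   exists N : nat, forall n m k l : nat, (N <= n)%N ->
     l%:R = alpha * n%:R -> m%:R = (alpha + beta) * n%:R ->
     k%:R = (alpha + gamma) * n%:R ->
     dev_prob n m k l mu eps <= eta)
  /\
  (* E[X] = n mu + o(n) along admissible n *)
  (forall eta : R, 0 < eta ->
   exists N : nat, forall n m k l : nat, (N <= n)%N ->
     l%:R = alpha * n%:R -> m%:R = (alpha + beta) * n%:R ->
     k%:R = (alpha + gamma) * n%:R ->
     `| expectation R n m k l - n%:R * mu | <= eta * n%:R).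
Proof.
move=> a0 b0 c0 d0 sum1 D mu.
have D0 : 0 <= D.
  (* Since the parameters sum to 1, the square is [1 - 4 (alpha + beta)(gamma + delta)], which
     differs from [D] by [4 beta delta]. *)
  have -> : D = (alpha + beta - gamma - delta) ^+ 2 + 4 * (beta * delta).
    by rewrite /D (_ : delta = 1 - alpha - beta - gamma); [ring | lra].
  by rewrite addr_ge0 ?sqr_ge0 ?mulr_ge0.
have D1 : D <= 1.
  by have := mulr_ge0 a0 c0; have := mulr_ge0 a0 d0; have := mulr_ge0 b0 c0; rewrite /D; lra.
have s0 : 0 <= Num.sqrt D by exact: sqrtr_ge0.
have s2 : Num.sqrt D ^+ 2 = D by exact: sqr_sqrtr.
have mu0 : 0 <= mu by rewrite /mu; nra.
have mu2 : mu <= 1 / 2 by rewrite /mu; lra.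
have mu_eq : mu * (1 - mu) = alpha * gamma + alpha * delta + beta * gamma.
  have -> : mu * (1 - mu) = (1 - Num.sqrt D ^+ 2) / 4 by rewrite /mu; field.
  by rewrite s2 /D; field.
have conc : forall eps : R, 0 < eps -> forall eta : R, 0 < eta ->
   exists N : nat, forall n m k l : nat, (N <= n)%N ->
     l%:R = alpha * n%:R -> m%:R = (alpha + beta) * n%:R ->
     k%:R = (alpha + gamma) * n%:R ->
     [/\ (0 < n)%N, \sum_(x < n./2.+1) pmf R n m k l x = 1
       & dev_prob n m k l mu eps <= eta].
  move=> eps e0 eta eta0.
  have pos : 0 <= (eps ^+ 2)^-1 + (eps ^+ 4 * eta)^-1.
    by rewrite addr_ge0 ?invr_ge0 ?mulr_ge0 ?exprn_ge0 ?ltW.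
  (* Beyond this bound [n] exceeds both [1 / eps^2], as the deviation bound requires, and
     [1 / (eps^4 eta)], which makes that bound at most [eta]. *)
  exists (Num.bound ((eps ^+ 2)^-1 + (eps ^+ 4 * eta)^-1)) => n m k l leN lE mE kE.
  have lt_n : (eps ^+ 2)^-1 + (eps ^+ 4 * eta)^-1 < n%:R.
    by apply: lt_le_trans (archi_boundP pos) _; rewrite ler_nat.
  have n0 : (0 < n)%N by rewrite -(ltr_nat R) (le_lt_trans pos).
  have n0R : 0 < n%:R :> R by rewrite ltr0n.
  have i1 : 0 < (eps ^+ 2)^-1 by rewrite invr_gt0 exprn_gt0.
  have i2 : 0 < (eps ^+ 4 * eta)^-1 by rewrite invr_gt0 mulr_gt0 ?exprn_gt0.
  have [sum_p moment] := Xi_concentration a0 b0 c0 d0 sum1 mu_eq lE mE kE.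
  split=> //; apply: le_trans (dev_prob_bound n0 mu0 mu2 e0 _ moment) _.
    by rewrite -ler_pdivrMl ?exprn_gt0 // mulr1; lra.
  rewrite invf_ple ?posrE ?mulr_gt0 ?exprn_gt0 //.
  have : (eps ^+ 4 * eta)^-1 <= n%:R by lra.
  rewrite invfM ler_pdivrMr // => h.
  by rewrite -ler_pdivrMl ?exprn_gt0 //; lra.
split=> [eps e0 eta eta0|eta eta0].
  have [N conN] := conc eps e0 eta eta0.
  by exists N => n m k l leN lE mE kE; have [] := conN n m k l leN lE mE kE.
(* Half of [eta] goes to the tolerance on [X/n] and half to the deviation probability. *)
have h0 : 0 < eta / 2 by lra.
have [N conN] := conc _ h0 _ h0.
exists N => n m k l leN lE mE kE; have [n0 sum_p dev] := conN n m k l leN lE mE kE.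
apply: le_trans (expectation_bound mu0 mu2 h0 n0 sum_p) _.
by rewrite mulrC ler_wpM2r //; lra.
Qed.
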